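(* An algebraic extension of fields $K/k$ is separable if and only if the ring map $k\rightarrow K$ is formally étale. In particular, if $k$ has characteristic zero, then every algebraic field extension of $k$ is formally étale over $k$.
   Context: All rings are commutative with $1$. A ring map $f:R\rightarrow S$ is formally étale if for every ring $A$, every ideal $I$ of $A$ with $I^{2}=0$, and all ring maps $h:R\rightarrow A$ and $h':S\rightarrow A/I$ with $\pi h=h'f$ (where $\pi:A\rightarrow A/I$ is the natural map), there is a unique ring map $g:S\rightarrow A$ with $gf=h$ and $\pi g=h'$. An algebraic extension $K/k$ is separable if every element of $K$ is separable over $k$. *)

(* Defs.v *)
From mathcomp Require Import all_boot all_algebra all_field.

Set Implicit Arguments.
Unset Strict Implicit.
Unset Printing Implicit Defensive.

Import GRing.Theory.

Local Open Scope ring_scope.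
Local Open Scope quotient_scope.

(* A field extension K/k is given by its structure map f : {rmorphism k -> K},
   K being of arbitrary degree over k. *)
Definition algebraic_extension (k K : fieldType) (f : {rmorphism k -> K}) :
    Prop :=
  forall x : K, algebraicOver f x.

(* A monic irreducible polynomial over k vanishing at x is the minimal
   polynomial of x; [separable_poly p] is coprimality of p and p^`(). *)
Definition separable_over (k K : fieldType) (f : {rmorphism k -> K}) (x : K) :
    Prop :=
  exists p : {poly k},
    [/\ p \is monic, irreducible_poly p, root (map_poly f p) x
      & separable_poly p].

Definition separable_extension (k K : fieldType) (f : {rmorphism k -> K}) :
    Prop :=
  forall x : K, separable_over f x.

(* [{ideal_quot I}] requires A nonzero and I proper. Nothing is lost:
   if I ^ 2 = 0 and 1 \in I, then A = 0, and over A = 0 the lifting condition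
   holds trivially. Ideals are boolean predicates, which classically is no
   restriction. Equality of ring maps is pointwise. *)
Definition formally_etale (R S : comPzRingType) (f : {rmorphism R -> S}) :
    Prop :=
  forall (A : comNzRingType) (I : idealr A),
    {in I &, forall u v : A, u * v = 0} ->
  forall (h : {rmorphism R -> A}) (h' : {rmorphism S -> {ideal_quot I}}),
    \pi_({ideal_quot I}) \o h =1 h' \o f ->
  exists g : {rmorphism S -> A},
    [/\ g \o f =1 h, \pi_({ideal_quot I}) \o g =1 h'
      & forall g' : {rmorphism S -> A},
          g' \o f =1 h -> \pi_({ideal_quot I}) \o g' =1 h' -> g' =1 g].

(* Main.v *)
Require Import Defs.
From mathcomp Require Import all_boot all_algebra all_field.
From mathcomp Require Import ring.
From HB Require Import structures.
From mathcomp Require Import boolp classical_sets.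

Set Implicit Arguments.
Unset Strict Implicit.
Unset Printing Implicit Defensive.

Import GRing.Theory.
Local Open Scope ring_scope.
Local Open Scope quotient_scope.

(** Separable implies formally etale.  Given K -> A/I with I of square zero, an
element x of K that is a simple root of a polynomial p over k has exactly one
lift to A that is a root of p: this is one step of Newton's method
([root_lift_exists], [root_lift_uniq]).  The assignment x |-> lift of x is
therefore forced, and only its compatibility with sums and products has to be
proved.  By Bezout, every polynomial relation over k satisfied by x is satisfied
by its lift ([root_lift_relations]), so that the lift extends to a ring map on
k(x) ([simple_extension_lift]).  Doing this twice lifts k(x, y), and the three
elements x, y and x - y (or x * y) are lifted compatibly there, as x and y stay
simple roots over any larger field.

Formally etale implies separable.  If the minimal polynomial m of x over k is
not separable, then m' = 0, the characteristic is some p > 0, and some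
coefficient c of m is not a p-th power, for otherwise m = C ^+ p and C is a
smaller polynomial vanishing at x.  There is a derivation D of k with D c = 1
([derivation_of_nonpower]).  A derivation of k is a ring map from k to the dual
numbers over k, and formal etaleness of K/k extends it to a derivation of K
([formally_etale_extends_derivation]).  Applying the extension to m(x) = 0 gives
m^D(x) + m'(x) D x = m^D(x) = 0, where m^D is obtained by applying D to the
coefficients of m; it is nonzero because D c = 1 and of smaller degree than m
because m is monic, contradicting minimality.

The derivation comes from a subfield M of k containing all p-th powers and
maximal among those that avoid c.  Maximality forces k = M(c)
([generated_by_nonpower]), and every polynomial relation of c over M is a
multiple of T ^ p - c ^ p ([XpsubC_dvd]), whose derivative is zero, so d/dc is
well defined. *)

(** * Ring maps given by graphs and by generators *)

Lemma rmorphism_of_graph (S A : comNzRingType) (G : S -> A -> Prop) :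
  (forall u, exists a, G u a) ->
  (forall u a b, G u a -> G u b -> a = b) ->
  G 1 1 ->
  (forall u v a b, G u a -> G v b -> G (u - v) (a - b)) ->
  (forall u v a b, G u a -> G v b -> G (u * v) (a * b)) ->
  exists phi : {rmorphism S -> A}, forall u, G u (phi u).
Proof.
move=> total functional G1 GB GM; have [phi Gphi] := choice total.
have phiB : zmod_morphism phi.
  by move=> u v; apply: functional (Gphi _) (GB _ _ _ _ (Gphi u) (Gphi v)).
have phiM : monoid_morphism phi.
  split; first exact: functional (Gphi _) G1.
  by move=> u v; apply: functional (Gphi _) (GM _ _ _ _ (Gphi u) (Gphi v)).
pose mB := GRing.isZmodMorphism.Build S A phi phiB.
pose mM := GRing.isMonoidMorphism.Build S A phi phiM.
pose phi' : {rmorphism S -> A} := HB.pack phi mB mM.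
by exists phi'.
Qed.

(** Two polynomials giving the same element at y differ by a relation of y, so
their values at a agree; the graph of the sought map is thus functional. *)
Lemma evaluation_rmorphism (F S A : comNzRingType) (f : {rmorphism F -> S})
    (h : {rmorphism F -> A}) (y : S) (a : A) :
  (forall u, exists P, (map_poly f P).[y] = u) ->
  (forall P, (map_poly f P).[y] = 0 -> (map_poly h P).[a] = 0) ->
  exists phi : {rmorphism S -> A},
    forall P, phi (map_poly f P).[y] = (map_poly h P).[a].
Proof.
move=> gen rel.
pose G u v := exists2 P, (map_poly f P).[y] = u & (map_poly h P).[a] = v.
have functional u v w : G u v -> G u w -> v = w.
  move=> [P Pu <-] [Q Qu <-]; apply/eqP; rewrite -subr_eq0.
  rewrite -hornerN -hornerD -rmorphB rel // rmorphB hornerD hornerN.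
  by rewrite Pu Qu subrr.
have [||||phi Gphi] := @rmorphism_of_graph S A G _ functional.
- by move=> u; have [P Pu] := gen u; exists (map_poly h P).[a]; exists P.
- by exists 1; rewrite rmorph1 hornerC.
- by move=> u v b c [P <- <-] [Q <- <-]; exists (P - Q);
  rewrite rmorphB hornerD hornerN.
- by move=> u v b c [P <- <-] [Q <- <-]; exists (P * Q);
  rewrite rmorphM hornerM.
by exists phi => P; apply: functional (Gphi _) _; exists P.
Qed.

(** The field k(y) for y algebraic, described by three properties so that its
construction need not be unfolded: it has a map to K, with image k[y]. *)
Lemma adjoin_root (F K : fieldType) (f : {rmorphism F -> K}) (y : K)
    (p : {poly F}) : p != 0 -> root (map_poly f p) y ->
  exists (E : fieldType) (j : {rmorphism F -> E}) (i : {rmorphism E -> K}),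
    [/\ i \o j =1 f, forall u, exists P, i u = (map_poly f P).[y]
      & forall P, exists u, i u = (map_poly f P).[y]].
Proof.
move=> p_neq0 py0.
exists (subFExtend f y p), (inj_subfx f y p), (@subfx_inj _ _ f y p); split.
- by move=> u; apply: etrans (subfx_inj_eval py0 p_neq0 u%:P) _;
  rewrite map_polyC hornerC.
- by move=> u; have [P ->] := subfxE u; exists P;
  apply: subfx_inj_eval py0 p_neq0 P.
- by move=> P; exists (subfx_eval f y p P); apply: subfx_inj_eval py0 p_neq0 P.
Qed.

(** * Lifting simple roots along a square-zero extension *)

(** This is the form of separability used for lifting: unlike separability of
the minimal polynomial, it passes to larger base fields with the same p. *)
Definition simple_root (F K : fieldType) (f : {rmorphism F -> K}) (p : {poly F})
    (x : K) : bool :=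
  root (map_poly f p) x && ~~ root (map_poly f p^`()) x.

Section SquareZero.

Variables (A B : comNzRingType) (pr : {rmorphism A -> B}).
Hypothesis pr_surj : forall b, exists a, pr a = b.
Hypothesis ker_sq0 : forall u v, pr u = 0 -> pr v = 0 -> u * v = 0.

(** If u w = 1 - e with e in the kernel, then e ^ 2 = 0, so w (1 + e) is an
inverse of u. *)
Lemma unit_lift (u : A) : (exists b, pr u * b = 1) -> exists v, u * v = 1.
Proof.
move=> [b ub1]; have [w wb] := pr_surj b.
have e0 : pr (1 - u * w) = 0 by rewrite rmorphB rmorphM rmorph1 wb ub1 subrr.
exists (w * (1 + (1 - u * w))).
have := ker_sq0 e0 e0; set e := 1 - u * w => ee.
have -> : u * (w * (1 + e)) = (1 - e) * (1 + e) by rewrite mulrA /e subKr.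
by rewrite mulrDr mulr1 mulrBl mul1r ee subr0 subrK.
Qed.

Lemma horner_add_sq0 (P : {poly A}) (a e : A) :
  e * e = 0 -> P.[a + e] = P.[a] + P^`().[a] * e.
Proof.
move=> ee; elim/poly_ind: P => [|P c IH].
  by rewrite deriv0 !horner0 mul0r addr0.
rewrite derivD derivM derivX derivC addr0 mulr1 !hornerE IH.
have -> : (P.[a] + P^`().[a] * e) * (a + e) + c =
    P.[a] * a + c + (P^`().[a] * a + P.[a]) * e + P^`().[a] * (e * e) by ring.
by rewrite ee mulr0 addr0.
Qed.

Variables (F K : fieldType) (f : {rmorphism F -> K}).
Variables (h : {rmorphism F -> A}) (h' : {rmorphism K -> B}).
Hypothesis hP : pr \o h =1 h' \o f.

Lemma pr_horner (P : {poly F}) (a : A) (y : K) :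
  pr a = h' y -> pr (map_poly h P).[a] = h' (map_poly f P).[y].
Proof.
move=> ay; rewrite -!horner_map ay -!map_poly_comp.
by rewrite (eq_map_poly hP).
Qed.

Lemma horner_lift_unit (P : {poly F}) (a : A) (y : K) :
  pr a = h' y -> ~~ root (map_poly f P) y ->
  exists v, (map_poly h P).[a] * v = 1.
Proof.
move=> ay Py; apply: unit_lift; exists (h' (map_poly f P).[y]^-1).
by rewrite (pr_horner _ ay) -rmorphM mulfV ?rmorph1.
Qed.

Variables (y : K) (p : {poly F}).
Hypothesis p_simple : simple_root f p y.

(** One Newton step a - p(a) / p'(a) from an arbitrary lift a of y: p(a) lies in
the kernel, so the remainder of order two vanishes. *)
Lemma root_lift_exists : exists2 a, pr a = h' y & (map_poly h p).[a] = 0.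
Proof.
have /andP[py0 dpy0] := p_simple; have [a ay] := pr_surj (h' y).
have [v uv] := horner_lift_unit ay dpy0.
set e := - ((map_poly h p).[a] * v).
have e0 : pr e = 0.
  by rewrite rmorphN rmorphM (pr_horner _ ay) (rootP py0) rmorph0 mul0r oppr0.
exists (a + e); first by rewrite rmorphD e0 addr0.
by rewrite (horner_add_sq0 _ _ (ker_sq0 e0 e0)) deriv_map
  mulrN mulrCA uv mulr1 subrr.
Qed.

(** For two lifts a and b, 0 = p(b) - p(a) = p'(a) (b - a) and p'(a) is a unit. *)
Lemma root_lift_uniq a b :
    pr a = h' y -> (map_poly h p).[a] = 0 ->
    pr b = h' y -> (map_poly h p).[b] = 0 -> a = b.
Proof.
move=> ay pa0 b_y pb0; have /andP[_ dpy0] := p_simple.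
have [v uv] := horner_lift_unit ay dpy0.
have e0 : pr (b - a) = 0 by rewrite rmorphB ay b_y subrr.
have := horner_add_sq0 (map_poly h p) a (ker_sq0 e0 e0).
rewrite addrC subrK pa0 pb0 add0r deriv_map => /esym/(congr1 (fun t => t * v)).
by rewrite mulrAC uv mul1r mul0r => /eqP; rewrite subr_eq0 => /eqP.
Qed.

(** Let d be the gcd of P and p, and p = c d.  Bezout gives d(y) = 0, and since
p'(y) = c(y) d'(y) is nonzero, c(a) is a unit.  From c(a) d(a) = p(a) = 0 it
follows that d(a) = 0, hence P(a) = 0. *)
Lemma root_lift_relations a (P : {poly F}) :
    pr a = h' y -> (map_poly h p).[a] = 0 ->
  (map_poly f P).[y] = 0 -> (map_poly h P).[a] = 0.
Proof.
move=> ay pa0 Py0; have /andP[py0 dpy0] := p_simple.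
set d := gcdp P p.
have dy0 : root (map_poly f d) y.
  by rewrite gcdp_map root_gcd py0 rootE Py0 eqxx.
have /dvdpP[c pE] : d %| p by apply: dvdp_gcdr.
have /dvdpP[e PE] : d %| P by apply: dvdp_gcdl.
have cy : ~~ root (map_poly f c) y.
  apply: contra dpy0 => cy0; rewrite pE derivM rmorphD !rmorphM rootE /= hornerD.
  by rewrite !hornerM (rootP cy0) (rootP dy0) mulr0 mul0r addr0.
have [v cv] := horner_lift_unit ay cy.
have da0 : (map_poly h d).[a] = 0.
  move: pa0; rewrite pE rmorphM hornerM => /(congr1 (fun t => v * t)).
  by rewrite mulrA (mulrC v) cv mul1r mulr0.
by rewrite PE rmorphM hornerM da0 mulr0.
Qed.

(** The field E is F(y).  The conclusion has the form of the hypotheses, with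
(F, f, h) replaced by (E, i, phi), so the lemma can be iterated. *)
Lemma simple_extension_lift :
  exists (E : fieldType) (j : {rmorphism F -> E}) (i : {rmorphism E -> K})
      (phi : {rmorphism E -> A}),
    [/\ i \o j =1 f, phi \o j =1 h, pr \o phi =1 h' \o i
      & exists u, i u = y].
Proof.
have /andP[py0 dpy0] := p_simple.
have p_neq0 : p != 0.
  by apply: contraNneq dpy0 => ->; rewrite deriv0 rmorph0 root0.
have [E [j [i [ij iE Ei]]]] := adjoin_root p_neq0 py0.
have [u uy] := Ei 'X; rewrite map_polyX hornerX in uy.
have [a ay pa0] := root_lift_exists.
have ievl P : i (map_poly j P).[u] = (map_poly f P).[y].
  by rewrite -horner_map -map_poly_comp uy (eq_map_poly ij).
have [v|P|phi phiE] := @evaluation_rmorphism F E A j h u a.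
- by have [P vP] := iE v; exists P; apply: (fmorph_inj i); rewrite ievl.
- move=> Pu0; apply: root_lift_relations => //.
  by rewrite -ievl Pu0 rmorph0.
exists E, j, i, phi; split=> //; last by exists u.
  by move=> x; have := phiE x%:P; rewrite !map_polyC !hornerC.
move=> v /=; have [P vP] := iE v.
have -> : v = (map_poly j P).[u] by apply: (fmorph_inj i); rewrite ievl.
by rewrite phiE ievl; apply: pr_horner.
Qed.

End SquareZero.

(** The lift is the relation G that sends x to the lift of x that is a root of
some polynomial of which x is a simple root.  By [root_lift_relations] this lift
does not depend on the polynomial, and it agrees with any partial lift E -> A
defined on an intermediate field ([mem]); sums and products are compared on an
intermediate field containing both arguments ([joint]). *)
Lemma simple_root_lift (A B : comNzRingType) (pr : {rmorphism A -> B})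
    (F K : fieldType) (f : {rmorphism F -> K})
    (h : {rmorphism F -> A}) (h' : {rmorphism K -> B}) :
  (forall b, exists a, pr a = b) ->
  (forall u v, pr u = 0 -> pr v = 0 -> u * v = 0) ->
  pr \o h =1 h' \o f ->
  (forall x, exists p, simple_root f p x) ->
  exists g : {rmorphism K -> A},
    [/\ g \o f =1 h, pr \o g =1 h'
      & forall g' : {rmorphism K -> A},
          g' \o f =1 h -> pr \o g' =1 h' -> g' =1 g].
Proof.
move=> pr_surj ker_sq0 hP sep.
pose G x a := pr a = h' x /\
  exists2 p, simple_root f p x & (map_poly h p).[a] = 0.
have total x : exists a, G x a.
  have [p px] := sep x.
  have [a ax pa] := root_lift_exists pr_surj ker_sq0 hP px; exists a.
  by split=> //; exists p.
have functional x a b : G x a -> G x b -> a = b.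
  move=> [ax [p px pa0]] [bx [q qx qb0]].
  apply: (root_lift_uniq pr_surj ker_sq0 hP px ax pa0 bx).
  have /andP[/rootP px0 _] := px.
  exact: (root_lift_relations pr_surj ker_sq0 hP qx bx qb0 px0).
have mem (E : fieldType) (j : {rmorphism F -> E}) (i : {rmorphism E -> K})
    (phi : {rmorphism E -> A}) u :
    i \o j =1 f -> phi \o j =1 h -> pr \o phi =1 h' \o i -> G (i u) (phi u).
  move=> ij phij phiP; split; first exact: phiP.
  have [p px] := sep (i u); exists p => //; have /andP[/rootP px0 _] := px.
  rewrite -(eq_map_poly phij) map_poly_comp horner_map.
  suff -> : (map_poly j p).[u] = 0 by rewrite rmorph0.
  by apply: (fmorph_inj i); rewrite rmorph0 -horner_map -map_poly_comp
    (eq_map_poly ij).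
have joint x y : exists (E : fieldType) (j : {rmorphism F -> E})
    (i : {rmorphism E -> K}) (phi : {rmorphism E -> A}),
    [/\ i \o j =1 f, phi \o j =1 h, pr \o phi =1 h' \o i
      & exists u v, i u = x /\ i v = y].
  have [p px] := sep x; have [q qy] := sep y.
  have [E1 [j1 [i1 [phi1 [ij1 phij1 phiP1 [u1 u1x]]]]]] :=
    simple_extension_lift pr_surj ker_sq0 hP px.
  have qy1 : simple_root i1 (map_poly j1 q) y.
    by rewrite /simple_root deriv_map -!map_poly_comp !(eq_map_poly ij1).
  have [E2 [j2 [i2 [phi2 [ij2 phij2 phiP2 [v vy]]]]]] :=
    simple_extension_lift pr_surj ker_sq0 phiP1 qy1.
  pose j : {rmorphism F -> E2} := j2 \o j1.
  exists E2, j, i2, phi2; split=> //.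
  - by move=> z /=; rewrite -ij1 -[RHS]ij2.
  - by move=> z /=; rewrite -phij1 -[RHS]phij2.
  by exists (j2 u1), v; split=> //; rewrite -u1x -[RHS]ij2.
have [|x y a b|x y a b|g Gg] := @rmorphism_of_graph K A G total functional.
- have [E [j [i [phi [ij phij phiP _]]]]] := joint 1 1.
  by have := mem E j i phi 1 ij phij phiP; rewrite !rmorph1.
- have [E [j [i [phi [ij phij phiP [u [v [<- <-]]]]]]]] := joint x y.
  have memE w := mem E j i phi w ij phij phiP.
  move=> /(functional _ _ _ (memE u)) <- /(functional _ _ _ (memE v)) <-.
  by rewrite -!rmorphB.
- have [E [j [i [phi [ij phij phiP [u [v [<- <-]]]]]]]] := joint x y.
  have memE w := mem E j i phi w ij phij phiP.
  move=> /(functional _ _ _ (memE u)) <- /(functional _ _ _ (memE v)) <-.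
  by rewrite -!rmorphM.
exists g; split=> [c|x|g' g'f g'P x].
- have [E [j [i [phi [ij phij phiP _]]]]] := joint 1 1.
  apply: functional (Gg _) _; rewrite -[h c]phij -[f c]ij.
  exact: mem ij phij phiP.
- by have [] := Gg x.
apply: functional (Gg x); split; first exact: g'P.
have [p px] := sep x; exists p => //; have /andP[/rootP px0 _] := px.
by rewrite -(eq_map_poly g'f) map_poly_comp horner_map px0 rmorph0.
Qed.

Lemma formally_etale_of_simple_roots (F K : fieldType) (f : {rmorphism F -> K}) :
  (forall x, exists p, simple_root f p x) -> formally_etale f.
Proof.
move=> sep A I I2 h h' hP.
pose pr : {rmorphism A -> {ideal_quot I}} := \pi_({ideal_quot I}).
have pr0 u : pr u = 0 -> u \in I.
  move=> u0; rewrite -[u]subr0 Quotient.idealrBE; apply/eqP.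
  by rewrite -[LHS]/(pr u) u0 -(rmorph0 pr).
apply: (simple_root_lift (pr := pr)) hP sep.
- by move=> b; exists (repr b); rewrite /pr /= reprK.
- by move=> u v /pr0 uI /pr0 vI; apply: I2.
Qed.

Lemma separable_simple_root (F K : fieldType) (f : {rmorphism F -> K}) x :
  separable_over f x -> exists p, simple_root f p x.
Proof.
move=> [p [_ _ px]]; rewrite unlock => sep_p; exists p; apply/andP; split=> //.
by apply: (coprimep_root _ px); rewrite coprimep_map.
Qed.


(** * Subfields avoiding an element that is not a p-th power *)

Section Subfield.

Variables (k : fieldType) (S : divringClosed k).

Definition subfield_type := {x : k | x \in S}.

HB.instance Definition _ := Choice.on subfield_type.
HB.instance Definition _ := SubType.on subfield_type.
HB.instance Definition _ := [SubChoice_isSubComUnitRing of subfield_type by <:].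
HB.instance Definition _ :=
  [SubComUnitRing_isSubIntegralDomain of subfield_type by <:].
HB.instance Definition _ :=
  [SubIntegralDomain_isSubField of subfield_type by <:].

End Subfield.

Lemma subfield_of_set (k : fieldType) (M : set k) :
  M 1 -> (forall u v, M u -> M v -> M (u - v)) ->
  (forall u v, M u -> M v -> M (u / v)) ->
  exists (F : fieldType) (i : {rmorphism F -> k}),
    forall u, M u <-> exists v, i v = u.
Proof.
move=> M1 MB MV.
have MS : GRing.divring_closed (fun u : k => `[< M u >]).
  split; first exact/asboolP.
    by move=> u v /asboolP Mu /asboolP Mv; apply/asboolP/MB.
  by move=> u v /asboolP Mu /asboolP Mv; apply/asboolP/MV.
pose mS := GRing.isDivringClosed.Build k (fun u => `[< M u >]) MS.
pose S : divringClosed k := HB.pack (fun u => `[< M u >]) mS.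
exists (subfield_type S), (\val : {rmorphism subfield_type S -> k}) => u.
split=> [Mu|[v <-]]; last exact/asboolP/(valP v).
have uS : u \in S by apply/asboolP.
by exists (Sub u uS); exact: SubK.
Qed.

Section CharP.

Variables (k : fieldType) (p : nat).
Hypothesis pchark : p \in [pchar k].

Let p_gt0 : (0 < p)%N := prime_gt0 (pcharf_prime pchark).

Lemma XpsubC_pchar (b : k) : 'X^p - (b ^+ p)%:P = ('X - b%:P) ^+ p.
Proof.
have pcharP : p \in [pchar {poly k}] by rewrite pchar_poly.
by rewrite rmorphXn -!(pFrobenius_autE pcharP) rmorphB.
Qed.

(** The gcd d of R and T ^ p - b ^ p divides (T - b) ^ p over k, hence is
(T - b) ^ e up to a scalar of F, and e > 0 as b is a common root.  If e < p, the
coefficient - e b of T ^ (e - 1) shows that b lies in F. *)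
Lemma XpsubC_dvd (F : fieldType) (i : {rmorphism F -> k}) (b : k) (beta : F) R :
    i beta = b ^+ p -> (forall u, i u <> b) -> (map_poly i R).[b] = 0 ->
  'X^p - beta%:P %| R.
Proof.
move=> ibeta b_notin Rb; set q := 'X^p - beta%:P.
have qE : map_poly i q = ('X - b%:P) ^+ p.
  by rewrite rmorphB /= map_polyXn map_polyC /= ibeta XpsubC_pchar.
have size_q : size q = p.+1 by rewrite size_XnsubC.
have q_neq0 : q != 0 by rewrite -size_poly_eq0 size_q.
set d := gcdp R q.
have d_dvd : d %| q by apply: dvdp_gcdr.
have d_neq0 : d != 0 by rewrite gcdp_eq0 negb_and q_neq0 orbT.
have : map_poly i d %| ('X - b%:P) ^+ p by rewrite -qE dvdp_map.
case/dvdp_exp_XsubCP=> e e_le dE.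
have size_d : size d = e.+1.
  by rewrite -(size_map_poly i) (eqp_size dE) size_exp_XsubC.
have e_gt0 : (0 < e)%N.
  rewrite lt0n; apply/eqP => e0; move: (eqp_root dE b).
  rewrite e0 expr0 rootC oner_eq0 gcdp_map root_gcd rootE Rb eqxx /=.
  by rewrite qE rootE !hornerE subrr expr0n gtn_eqF ?eqxx.
have [e_lt|p_le] := ltnP e p; last first.
  have dq : d %= q
    by rewrite -(dvdp_size_eqp d_dvd) size_d size_q eqSS eqn_leq e_le.
  by rewrite -(eqp_dvdl R dq) dvdp_gcdl.
(* b is recovered from the two leading coefficients of d, as e is a unit in k. *)
case: (b_notin (- d`_e.-1 / lead_coef d / e%:R)).
have lead_neq0 : lead_coef d != 0 by rewrite lead_coef_eq0.
have e_neq0 : e%:R != 0 :> k.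
  by rewrite -(dvdn_pcharf pchark) gtnNdvd.
have := congr1 (fun P : {poly k} => P`_e.-1) (eqp_eq dE).
rewrite !coefZ (eqP (monic_exp e (monicXsubC b))) mul1r coef_map lead_coef_map.
have := @coefPn_prod_XsubC k (nseq e b).
rewrite size_nseq -lt0n !big_nseq iter_mulr_1 iter_addr_0 => -> // coefE.
rewrite !fmorph_div rmorphN rmorph_nat coefE mulrN opprK.
by rewrite [X in X / _ / _]mulrC mulfK ?fmorph_eq0 // -[b *+ e]mulr_natr mulfK.
Qed.


(** Zorn's lemma for subrings containing all p-th powers; such a subring is a
field because v^-1 = v ^+ p.-1 * v^-1 ^+ p.  If b is not in the maximal one, M,
then M[b] is too large to avoid c. *)
Lemma maximal_subfield (c : k) :
  (forall u, u ^+ p <> c) ->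
  exists (F : fieldType) (i : {rmorphism F -> k}),
    [/\ forall u, exists v, i v = u ^+ p, forall v, i v <> c
      & forall b, (exists v, i v = b) \/ exists P, (map_poly i P).[b] = c].
Proof.
move=> c_nopow.
pose good (M : set k) := [/\ M 1, forall u v, M u -> M v -> M (u - v),
  forall u v, M u -> M v -> M (u * v), forall u, M (u ^+ p) & ~ M c].
(* The empty set is admitted because it is the union of the empty chain. *)
have [|M [Mgood Mmax]] := @Zorn_bigcup k (fun M => (exists u, M u) -> good M).
  move=> C Cgood Ctot [u0 [X0 CX0 X0u]].
  have {}Cgood X u : C X -> X u -> good X.
    by move=> CX Xu; apply: Cgood => //; exists u.
  have [X01 _ _ X0p _] := Cgood _ _ CX0 X0u.
  have pair X Y u v : C X -> C Y -> X u -> Y v -> exists2 Z, C Z & Z u /\ Z v.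
    move=> CX CY Xu Yv; have [XY|YX] := Ctot X Y CX CY.
      by exists Y => //; split=> //; apply: XY.
    by exists X => //; split=> //; apply: YX.
  split; first by exists X0.
  - move=> u v [X CX Xu] [Y CY Yv].
    have [Z CZ [Zu Zv]] := pair _ _ _ _ CX CY Xu Yv.
    by exists Z => //; have [_ + _ _ _] := Cgood _ _ CZ Zu; apply.
  - move=> u v [X CX Xu] [Y CY Yv].
    have [Z CZ [Zu Zv]] := pair _ _ _ _ CX CY Xu Yv.
    by exists Z => //; have [_ _ + _ _] := Cgood _ _ CZ Zu; apply.
  - by move=> u; exists X0.
  by move=> [X CX Xc]; have [_ _ _ _] := Cgood _ _ CX Xc; apply.
pose M0 : set k := fun u => exists v, u = v ^+ p.
have M0good : good M0.
  split; first by exists 1; rewrite expr1n.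
  - move=> _ _ [u ->] [v ->]; exists (u - v).
    by rewrite -!(pFrobenius_autE pchark) rmorphB.
  - by move=> _ _ [u ->] [v ->]; exists (u * v); rewrite exprMn.
  - by move=> u; exists u.
  by move=> [u cu]; apply: (c_nopow u).
have {Mgood} [M1 MB MM Mp Mc] : good M.
  have [Mne|M_empty] := pselect (exists u, M u); first exact: Mgood Mne.
  case: (Mmax M0) => //; split=> [u Mu|M0M]; first by case: M_empty; exists u.
  by case: M_empty; exists 1; apply: M0M; have [] := M0good.
have MV u v : M u -> M v -> M (u / v).
  move=> Mu Mv; have [->|v_neq0] := eqVneq v 0.
    by rewrite invr0 mulr0 -(subrr 1); apply: MB.
  have -> : v^-1 = v ^+ p.-1 * v^-1 ^+ p.
    by rewrite -{2}(prednK p_gt0) exprS mulrCA -exprMn mulfV // expr1n mulr1.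
  apply: (MM) => //; apply: (MM) => //.
  by elim: p.-1 => [|n IH]; rewrite ?expr0 // exprS; apply: MM.
have [F [i iE]] := subfield_of_set M1 MB MV.
exists F, i; split.
- by move=> u; apply/iE.
- by move=> v ivc; apply: Mc; apply/iE; exists v.
move=> b; have [Mb|nMb] := pselect (M b); first by left; apply/iE.
right; pose N : set k := fun u => exists P, (map_poly i P).[b] = u.
have MN : (M `<=` N)%classic.
  by move=> u /iE[v <-]; exists v%:P; rewrite map_polyC hornerC.
apply: contrapT => nNc; apply: (Mmax N).
  split=> // NM; apply/nMb/NM; exists 'X; by rewrite map_polyX hornerX.
move=> _; split=> //; first exact: MN.
- by move=> _ _ [P <-] [Q <-]; exists (P - Q); rewrite rmorphB hornerD hornerN.
- by move=> _ _ [P <-] [Q <-]; exists (P * Q); rewrite rmorphM hornerM.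
by move=> u; apply: MN.
Qed.

(** Suppose that b is not in M(c).  By maximality c = P(b) with P over M, and P
may be reduced modulo T ^ p - b ^ p to a polynomial Q of degree less than p.  But
over M(c) every relation of b is a multiple of T ^ p - b ^ p, so the relation
Q - c is zero and c, being the constant Q, lies in M. *)
Lemma generated_by_nonpower (c : k) :
  (forall u, u ^+ p <> c) ->
  exists (F : fieldType) (i : {rmorphism F -> k}),
    [/\ forall u, exists v, i v = u ^+ p, forall v, i v <> c
      & forall b, exists P, (map_poly i P).[c] = b].
Proof.
move=> c_nopow; have [F [i [ip ic imax]]] := maximal_subfield c_nopow.
exists F, i; split=> // b.
have [gamma gammaE] := ip c; have [beta betaE] := ip b.
have q_neq0 : 'X^p - gamma%:P != 0 :> {poly F}.
  by rewrite -size_poly_eq0 size_XnsubC.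
have qc0 : root (map_poly i ('X^p - gamma%:P)) c.
  by rewrite rmorphB /= map_polyXn map_polyC /= gammaE rootE !hornerE subrr.
have [E [j [l [lj lE El]]]] := adjoin_root q_neq0 qc0.
have [[u ub]|b_notin] := pselect (exists u, l u = b).
  by have [P] := lE u; rewrite ub => Pb; exists P.
have [[v vb]|[P Pc]] := imax b.
  by exists v%:P; rewrite map_polyC hornerC.
have [c' c'c] := El 'X; rewrite map_polyX hornerX in c'c.
pose r := 'X^p - beta%:P; pose Q := P %% r.
have size_r : size r = p.+1 by rewrite size_XnsubC.
have Qb : (map_poly i Q).[b] = c.
  rewrite -[RHS]Pc [in RHS](divp_eq P r) rmorphD rmorphM hornerD hornerM -/Q.
  by rewrite rmorphB /= map_polyXn map_polyC /= betaE !hornerE subrr mulr0 add0r.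
have lj_map (R : {poly F}) : map_poly l (map_poly j R) = map_poly i R.
  by rewrite -map_poly_comp (eq_map_poly lj).
have dvd : 'X^p - (j beta)%:P %| map_poly j Q - c'%:P.
  apply: (XpsubC_dvd (i := l) (b := b)).
  - by rewrite -betaE -[RHS]lj.
  - by move=> u ub; apply: b_notin; exists u.
  by rewrite rmorphB /= lj_map map_polyC /= hornerD hornerN hornerC Qb c'c subrr.
have Qc' : map_poly j Q = c'%:P.
  apply/eqP; rewrite -subr_eq0; apply: contraTT dvd => nz.
  rewrite gtNdvdp // size_XnsubC //.
  rewrite (leq_ltn_trans (size_polyD _ _)) // gtn_max size_polyN size_map_poly.
  rewrite -{1}size_r ltn_modp -size_poly_eq0 size_r /=.
  by rewrite (leq_ltn_trans (size_polyC_leq1 _)) // ltnS.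
have [v vc] : exists v, Q = v%:P.
  exists Q`_0; apply: size1_polyC.
  by rewrite -(size_map_poly j) Qc' size_polyC_leq1.
by case: (ic v); rewrite -[RHS]Qb vc map_polyC hornerC.
Qed.

End CharP.

(** * Dual numbers and derivations *)

(** The pair (a, b) stands for a + b eps with eps ^ 2 = 0.  The type is a copy of
the product, whose componentwise multiplication is not the one wanted. *)
Definition dual_number (K : Type) := (K * K)%type.

Section DualNumbers.

Variable K : comNzRingType.
Local Notation dual := (dual_number K).

HB.instance Definition _ := GRing.Zmodule.on dual.

Definition dual_mul (a b : dual) : dual := (a.1 * b.1, a.1 * b.2 + a.2 * b.1).

Fact dual_mulA : associative dual_mul.
Proof. by move=> a b c; congr (_, _) => /=; ring. Qed.

Fact dual_mulC : commutative dual_mul.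
Proof. by move=> a b; congr (_, _) => /=; ring. Qed.

Fact dual_mul1 : left_id ((1, 0) : dual) dual_mul.
Proof. by case=> a b; congr (_, _) => /=; ring. Qed.

Fact dual_mulDl : left_distributive dual_mul +%R.
Proof. by move=> a b c; congr (_, _) => /=; ring. Qed.

Fact dual_1neq0 : ((1, 0) : dual) != 0.
Proof. by rewrite -pair_eqE /= negb_and oner_eq0. Qed.

HB.instance Definition _ := GRing.Zmodule_isComNzRing.Build dual
  dual_mulA dual_mulC dual_mul1 dual_mulDl dual_1neq0.

Definition dual_re (a : dual) : K := a.1.
Definition dual_const (c : K) : dual := (c, 0).

Fact dual_re_zmod_morphism : zmod_morphism dual_re. Proof. by []. Qed.
Fact dual_re_monoid_morphism : monoid_morphism dual_re. Proof. by []. Qed.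
HB.instance Definition _ :=
  GRing.isZmodMorphism.Build dual K dual_re dual_re_zmod_morphism.
HB.instance Definition _ :=
  GRing.isMonoidMorphism.Build dual K dual_re dual_re_monoid_morphism.

Fact dual_const_zmod_morphism : zmod_morphism dual_const.
Proof. by move=> a b; congr (_, _); rewrite /= subr0. Qed.
Fact dual_const_monoid_morphism : monoid_morphism dual_const.
Proof. by split=> // a b; congr (_, _); rewrite /= mulr0 mul0r addr0. Qed.
HB.instance Definition _ :=
  GRing.isZmodMorphism.Build K dual dual_const dual_const_zmod_morphism.
HB.instance Definition _ :=
  GRing.isMonoidMorphism.Build K dual dual_const dual_const_monoid_morphism.

Lemma dual_re_sq0 (u v : dual) : u.1 = 0 -> v.1 = 0 -> u * v = 0.
Proof.
by move=> u0 v0; congr (_, _) => /=; rewrite u0 v0 !(mul0r, mulr0) ?addr0.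
Qed.

Lemma dual_im_sum n (a : 'I_n -> dual) (b : 'I_n -> K) :
  (\sum_(i < n) a i * dual_const (b i)).2 = \sum_(i < n) (a i).2 * b i.
Proof.
rewrite (big_morph (fun u : dual => u.2) (id1 := 0) (op1 := +%R)) //.
by apply: eq_bigr => i _; rewrite /= mulr0 add0r.
Qed.

Definition dual_ideal : pred dual := fun a => a.1 == 0.

Fact dual_idealr_closed : idealr_closed dual_ideal.
Proof.
split; first exact: eqxx; first by rewrite unfold_in /= oner_eq0.
move=> a u v; rewrite !unfold_in /= => /eqP u0 /eqP v0.
by rewrite u0 v0 mulr0 addr0.
Qed.
HB.instance Definition _ := isIdealr.Build dual dual_ideal dual_idealr_closed.

End DualNumbers.

Section DualMap.

Variables (K L : comNzRingType) (f : {rmorphism K -> L}).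

Definition dual_map (a : dual_number K) : dual_number L := (f a.1, f a.2).

Fact dual_map_zmod_morphism : zmod_morphism dual_map.
Proof. by move=> a b; congr (_, _); rewrite rmorphB. Qed.
Fact dual_map_monoid_morphism : monoid_morphism dual_map.
Proof.
split; first by congr (_, _); rewrite ?rmorph1 ?rmorph0.
by move=> a b; congr (_, _); rewrite /= ?rmorphD !rmorphM.
Qed.
HB.instance Definition _ := GRing.isZmodMorphism.Build
  (dual_number K) (dual_number L) dual_map dual_map_zmod_morphism.
HB.instance Definition _ := GRing.isMonoidMorphism.Build
  (dual_number K) (dual_number L) dual_map dual_map_monoid_morphism.

End DualMap.

(** The second component of phi is the derivation d/dc of k = M(c): phi is
evaluation at c + eps of polynomials over M, and (c + eps) ^ p = c ^ p shows that
it respects the relations of c. *)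
Lemma derivation_of_nonpower (k : fieldType) (p : nat) (c : k) :
  p \in [pchar k] -> (forall u, u ^+ p <> c) ->
  exists phi : {rmorphism k -> dual_number k},
    (forall u, (phi u).1 = u) /\ (phi c).2 = 1.
Proof.
move=> pchark c_nopow.
have [F [i [ip ic gen]]] := generated_by_nonpower pchark c_nopow.
pose h : {rmorphism F -> dual_number k} := @dual_const k \o i.
pose a : dual_number k := (c, 1).
have [gamma gammaE] := ip c.
have aX : a ^+ p = dual_const (c ^+ p).
  pose eps : dual_number k := (0, 1).
  have pcharD : p \in [pchar (dual_number k)].
    exact: (rmorph_pchar (@dual_const k)).
  have -> : a = dual_const c + eps by congr (_, _); rewrite /= ?addr0 ?add0r.
  rewrite -(pFrobenius_autE pcharD) rmorphD /= !(pFrobenius_autE pcharD) -rmorphXn.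
  have := prime_gt1 (pcharf_prime pchark).
  case: (p) => [|[|n]] // _.
  have eps2 : eps * eps = 0 by apply: dual_re_sq0.
  by rewrite [eps ^+ _]exprS [eps ^+ _]exprS mulrA eps2 mul0r addr0.
have [||phi phiE] := @evaluation_rmorphism F k (dual_number k) i h c a => //.
  move=> P Pc0; have /dvdpP[Q ->] := XpsubC_dvd pchark gammaE ic Pc0.
  rewrite rmorphM hornerM rmorphB /= map_polyXn map_polyC /= gammaE.
  by rewrite !hornerE aX subrr mulr0.
exists phi; split=> [u|].
  have [P <-] := gen u; rewrite phiE -/(dual_re _) -horner_map -map_poly_comp.
  by congr (_.[_]); apply: eq_map_poly.
by have := phiE 'X; rewrite !map_polyX !hornerX => ->.
Qed.

(** * Minimal polynomials and inseparability *)

Section MinimalPolynomial.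

Variables (k K : fieldType) (f : {rmorphism k -> K}) (x : K).

Lemma exists_min_poly : algebraicOver f x ->
  exists m : {poly k}, [/\ m \is monic, root (map_poly f m) x
    & forall q, q != 0 -> root (map_poly f q) x -> (size m <= size q)%N].
Proof.
move=> [q0 q0_neq0 q0x].
pose ann n := `[< exists q, [/\ q != 0, root (map_poly f q) x & size q = n] >].
have ex : exists n, ann n by exists (size q0); apply/asboolP; exists q0.
case: (ex_minnP ex) => n /asboolP[q [q_neq0 qx qn]] n_min.
have lead_neq0 : (lead_coef q)^-1 != 0 by rewrite invr_eq0 lead_coef_eq0.
exists ((lead_coef q)^-1 *: q); split.
- by rewrite monicE lead_coefZ mulVf // lead_coef_eq0.
- by rewrite rootE linearZ hornerZ (rootP qx) mulr0.
move=> r r_neq0 rx; rewrite size_scale // qn.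
by apply: n_min; apply/asboolP; exists r.
Qed.

Variable m : {poly k}.
Hypotheses (m_monic : m \is monic) (mx : root (map_poly f m) x).
Hypothesis m_min :
  forall q, q != 0 -> root (map_poly f q) x -> (size m <= size q)%N.

Let m_neq0 : m != 0 := monic_neq0 m_monic.

Lemma min_poly_size_gt1 : (1 < size m)%N.
Proof.
by rewrite -(size_map_poly f); apply: root_size_gt1 mx; rewrite map_poly_eq0.
Qed.

Lemma min_poly_irreducible : irreducible_poly m.
Proof.
split=> [|q size_q /dvdpP[r mE]]; first exact: min_poly_size_gt1.
have := m_neq0; rewrite mE mulf_eq0 negb_or => /andP[r_neq0 q_neq0].
have q_dvd : q %| r * q by apply: dvdp_mulIr.
have := mx; rewrite mE rmorphM rootM => /orP[rx|qx]; last first.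
  by rewrite -(dvdp_size_eqp q_dvd) eqn_leq dvdp_leq ?mulf_neq0 // -{1}mE m_min.
have := m_min r_neq0 rx; rewrite mE size_mul // => size_le.
have q_gt1 : (1 < size q)%N by rewrite ltn_neqAle eq_sym size_q size_poly_gt0.
case: (size q) q_gt1 size_le => [|[|s]] // _.
by rewrite !addnS /= ltnNge leq_addr.
Qed.

Lemma min_poly_separable : m^`() != 0 -> separable_poly m.
Proof.
move=> dm_neq0; rewrite unlock; apply: contraNT dm_neq0 => ncop.
have /(apply_irredp min_poly_irreducible ncop) := dvdp_gcdl m m^`().
move/eqp_dvdl => /(_ m^`()); rewrite dvdp_gcdr => /esym.
by apply: contraTT => dm_neq0; rewrite gtNdvdp // lt_size_deriv.
Qed.

(** As m is monic of degree n > 0, the coefficient of T ^ (n - 1) in m' is n, so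
n is zero in k. *)
Lemma exists_pchar : m^`() = 0 -> exists p, p \in [pchar k].
Proof.
move=> dm0; pose n := (size m).-1.
have n_gt0 : (0 < n)%N by rewrite /n -subn1 subn_gt0 min_poly_size_gt1.
have := congr1 (fun q : {poly k} => q`_n.-1) dm0.
rewrite coef0 coef_deriv prednK // -[m`_n]/(lead_coef m) (eqP m_monic).
by move/eqP/natf0_pchar; apply.
Qed.

(** As m' = 0, only exponents divisible by p occur in m.  If all coefficients
were p-th powers, m would be C ^+ p by additivity of Frobenius, and C would
vanish at x with smaller degree. *)
Lemma min_poly_nonpower_coef p : p \in [pchar k] -> m^`() = 0 ->
  exists i, forall u, u ^+ p <> m`_i.
Proof.
move=> pchark dm0; apply: contrapT => all_pow.
have pow i : exists u, u ^+ p = m`_i.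
  apply: contrapT => no_u; apply: all_pow; exists i => u um.
  by apply: no_u; exists u.
have [b bE] := choice pow.
(* When p does not divide i, the coefficient and so b i are zero, which makes
   the rounding in i %/ p harmless. *)
pose C : {poly k} := \sum_(i < size m) b i *: 'X^(i %/ p).
have pcharP : p \in [pchar {poly k}] by rewrite pchar_poly.
have mE : m = C ^+ p.
  rewrite -(pFrobenius_autE pcharP) rmorph_sum -[LHS]coefK poly_def.
  apply: eq_bigr => i _ /=; rewrite pFrobenius_autE exprZn bE -exprM.
  have [p_i|p_ni] := boolP (p %| i)%N; first by rewrite divnK.
  suff -> : m`_i = 0 by rewrite !scale0r.
  have i_gt0 : (0 < i)%N by case: (i : nat) p_ni => //; rewrite dvdn0.
  have := congr1 (fun q : {poly k} => q`_i.-1) dm0.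
  rewrite coef0 coef_deriv prednK // -mulr_natr => /eqP.
  by rewrite mulf_eq0 -(dvdn_pcharf pchark) (negPf p_ni) orbF => /eqP.
have p_gt1 := prime_gt1 (pcharf_prime pchark).
have C_neq0 : C != 0.
  by apply: contraNneq m_neq0 => C0; rewrite mE C0 expr0n gtn_eqF // ltnW.
have Cx : root (map_poly f C) x.
  by move: mx; rewrite mE rmorphXn /= rootE horner_exp expf_eq0 => /andP[].
have := m_min C_neq0 Cx; rewrite leqNgt => /negP; apply.
have := min_poly_size_gt1; rewrite mE.
have := size_exp C p.
case: (size C) (size _) => [|[|n]] [|s] //= -> //.
by move=> _; rewrite ltnS ltn_Pmulr.
Qed.

End MinimalPolynomial.

(** * The two implications *)

Lemma separable_of_deriv (k K : fieldType) (f : {rmorphism k -> K}) x m :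
    m \is monic -> root (map_poly f m) x ->
    (forall q, q != 0 -> root (map_poly f q) x -> (size m <= size q)%N) ->
  m^`() != 0 -> separable_over f x.
Proof.
move=> m_monic mx m_min dm_neq0; exists m; split=> //.
  exact: min_poly_irreducible m_monic mx m_min.
exact: min_poly_separable m_monic mx m_min dm_neq0.
Qed.

Lemma pchar0_separable (k K : fieldType) (f : {rmorphism k -> K}) :
  [pchar k] =i pred0 -> algebraic_extension f -> separable_extension f.
Proof.
move=> char0 alg x; have [m [m_monic mx m_min]] := exists_min_poly (alg x).
apply: (separable_of_deriv m_monic mx m_min); apply/negP => /eqP dm0.
by have [p] := exists_pchar m_monic mx dm0; rewrite char0.
Qed.

(** Lifting problem: k -> K[eps], u |-> u + D u eps, against the identity of
K = K[eps] / (eps). *)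
Lemma formally_etale_extends_derivation (k K : fieldType)
    (f : {rmorphism k -> K}) (phi : {rmorphism k -> dual_number k}) :
  formally_etale f -> (forall u, (phi u).1 = u) ->
  exists g : {rmorphism K -> dual_number K},
    (forall u, g (f u) = dual_map f (phi u)) /\ forall x, (g x).1 = x.
Proof.
move=> etale phi1; pose I : idealr (dual_number K) := @dual_ideal K.
have I2 : {in I &, forall u v : dual_number K, u * v = 0}.
  by move=> u v /eqP u0 /eqP v0; apply: dual_re_sq0.
pose h : {rmorphism k -> dual_number K} := dual_map f \o phi.
pose h' : {rmorphism K -> {ideal_quot I}} :=
  \pi_({ideal_quot I}) \o @dual_const K.
have hE : \pi_({ideal_quot I}) \o h =1 h' \o f.
  move=> u; apply/eqP; rewrite -[_ == _]Quotient.idealrBE.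
  by rewrite unfold_in /= phi1 subrr.
have [g [gf gpi _]] := etale _ I I2 h h' hE.
exists g; split=> [u|x]; first exact: gf.
have /eqP := gpi x; rewrite -[_ == _]Quotient.idealrBE unfold_in /= subr_eq0.
by move/eqP.
Qed.

Lemma formally_etale_separable (k K : fieldType) (f : {rmorphism k -> K}) :
  algebraic_extension f -> formally_etale f -> separable_extension f.
Proof.
move=> alg etale x; have [m [m_monic mx m_min]] := exists_min_poly (alg x).
apply: (separable_of_deriv m_monic mx m_min); apply/negP => /eqP dm0.
have [p pchark] := exists_pchar m_monic mx dm0.
have [i i_nopow] := min_poly_nonpower_coef m_monic mx m_min pchark dm0.
have [phi [phi1 phi_i]] := derivation_of_nonpower pchark i_nopow.
have [g [gf g1]] := formally_etale_extends_derivation etale phi1.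
pose n := (size m).-1.
have size_m : size m = n.+1 by rewrite prednK // size_poly_gt0 monic_neq0.
have D_ge j : (n <= j)%N -> (phi m`_j).2 = 0.
  rewrite leq_eqVlt => /predU1P[<-|n_lt].
    by rewrite -[m`_n]/(lead_coef m) (eqP m_monic) rmorph1.
  by rewrite nth_default ?size_m // rmorph0.
have i_lt : (i < n)%N.
  by rewrite ltnNge; apply/negP => /D_ge; rewrite phi_i => /eqP; rewrite oner_eq0.
pose mD : {poly k} := \poly_(j < n) (phi m`_j).2.
have mD_neq0 : mD != 0.
  apply/eqP => /(congr1 (fun q : {poly k} => q`_i)) /eqP.
  by rewrite coef_poly i_lt phi_i coef0 oner_eq0.
suff mDx : root (map_poly f mD) x.
  by have := m_min _ mD_neq0 mDx; rewrite size_m leqNgt ltnS size_poly.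
pose h : {rmorphism k -> dual_number K} := dual_map f \o phi.
have evalE (P : {poly k}) : (map_poly h P).[g x] = g (map_poly f P).[x].
  by rewrite -horner_map -map_poly_comp (eq_map_poly gf).
pose e := g x - dual_const x.
have e2 : e * e = 0 by apply: dual_re_sq0; rewrite /= g1 subrr.
(* Since m' = 0, the value of m at g x = x + e equals its value at x, so the
   derivative of x drops out. *)
have : (map_poly h m).[dual_const x] = 0.
  have := horner_add_sq0 (map_poly h m) (dual_const x) e2.
  rewrite deriv_map dm0 rmorph0 horner0 mul0r addr0 addrC subrK => <-.
  by rewrite evalE (rootP mx) rmorph0.
rewrite (@horner_coef_wide _ n.+1); last by rewrite -size_m size_poly.
move/(congr1 (fun a : dual_number K => a.2)).
under eq_bigr => j _ do rewrite -rmorphXn.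
rewrite dual_im_sum big_ord_recr /= coef_map /= D_ge // rmorph0 mul0r addr0 => sum0.
apply/rootP; rewrite (@horner_coef_wide _ n); last first.
  by rewrite size_map_poly size_poly.
rewrite -[RHS]sum0; apply: eq_bigr => j _.
by rewrite !coef_map /= coef_poly ltn_ord.
Qed.

Theorem lemma1p3 (k : fieldType) :
  (forall (K : fieldType) (f : {rmorphism k -> K}),
     algebraic_extension f -> (separable_extension f <-> formally_etale f)) /\
  ([pchar k] =i pred0 ->
   forall (K : fieldType) (f : {rmorphism k -> K}),
     algebraic_extension f -> formally_etale f).
Proof.
have sep_etale (K : fieldType) (f : {rmorphism k -> K}) :
    separable_extension f -> formally_etale f.
  move=> sep; apply: formally_etale_of_simple_roots => x.
  exact: separable_simple_root.
split=> [K f alg|char0 K f alg]; last exact/sep_etale/pchar0_separable.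
split; [exact: sep_etale | exact: formally_etale_separable].
Qed.
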